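(* Let $(\Omega,\preceq)$ be a totally preordered space with smallest element $0_\Omega$ and largest element $1_\Omega$. Let $(\underline F,\overline F)$ be a p-box on $(\Omega,\preceq)$ such that the p-boxes $(\underline F_1=\underline F,\ \overline F_1=I_\Omega)$ and $(\underline F_2=I_{[1_\Omega]_\simeq},\ \overline F_2=\overline F)$ are possibility measures. Then $(\underline F,\overline F)$ is the intersection of the two possibility measures $\Pi_1,\Pi_2$ defined by the possibility distributions $$\pi_1(x)=1-\underline F(x-),\qquad \pi_2(x)=\overline F(x),$$ in the sense that $\mathcal M(\overline P_{\underline F,\overline F})=\mathcal M(\Pi_1)\cap\mathcal M(\Pi_2)$.
   Context: A total preorder $\preceq$ is reflexive, transitive, with any two elements comparable; $x\prec y$ means $x\preceq y$ and not $y\preceq x$; $x\simeq y$ means $x\preceq y$ and $y\preceq x$; $[x]_\simeq=\{y:y\simeq x\}$. A formal element $0_\Omega-$ is added: $\Omega^*=\Omega\cup\{0_\Omega-\}$ with $0_\Omega-\prec x$ for all $x\in\Omega$. A cumulative distribution function is a non-decreasing map $F:\Omega\to[0,1]$ with $F(1_\Omega)=1$, extended to $\Omega^*$ by $F(0_\Omega-)=0$. A p-box is a pair $(\underline F,\overline F)$ of cumulative distribution functions with $\underline F\le\overline F$. For $x\in\Omega$, $F(x-)=\sup_{z\in\Omega^*,\,z\prec x}F(z)$. $I_S$ denotes the indicator function of $S$; so $I_\Omega$ is constantly $1$ on $\Omega$. $\mathcal M(\overline P_{\underline F,\overline F})$ is the set of finitely additive probabilities $P$ on the power set of $\Omega$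 with $\underline F(x)\le P([0_\Omega,x])\le\overline F(x)$ for all $x\in\Omega$, where $[0_\Omega,x]=\{z\in\Omega:z\preceq x\}$. The natural extension is $\overline E_{\underline F,\overline F}(A)=\sup\{P(A):P\in\mathcal M(\overline P_{\underline F,\overline F})\}$ for $A\subseteq\Omega$. A p-box ''is a possibility measure'' if $\overline E_{\underline F,\overline F}(A)=\sup_{x\in A}\overline E_{\underline F,\overline F}(\{x\})$ for all $A\subseteq\Omega$ (with $\sup\emptyset=0$). For a possibility distribution $\pi:\Omega\to[0,1]$ ($\sup\pi=1$), $\Pi(A)=\sup_{x\in A}\pi(x)$, and $\mathcal M(\Pi)$ is the set of finitely additive probabilities $P$ on the power set of $\Omega$ with $P(A)\le\Pi(A)$ for all $A\subseteq\Omega$. *)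

(* Defs.v *)
(* MathComp / MathComp-Analysis. *)
From mathcomp Require Import all_boot all_order all_algebra.
From mathcomp Require Import all_classical all_reals all_analysis.

Set Implicit Arguments.
Unset Strict Implicit.
Unset Printing Implicit Defensive.

Import Order.TTheory GRing.Theory Num.Theory.
Local Open Scope classical_set_scope.
Local Open Scope ring_scope.

Section Preorder.
Context {d : Order.disp_t} {T : tbPreorderType d}.

Definition simeq (x y : T) : bool := ((x <= y) && (y <= x))%O.

Definition simeq_class (x : T) : set T := [set y | simeq y x].

(* [0, x] *)
Definition initial_segment (x : T) : set T := [set z | (z <= x)%O].

(* The strict order of [T] extended by a formal element below all of [T];
   [None] is that element 0-, and [Some x] is the element [x] of [T]. *)
Definition lt_star (z w : option T) : bool :=
  match z, w with
  | None, Some _ => true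
  | Some z', Some x => (z' < x)%O
  | _, None => false
  end.

End Preorder.

Section PBox.
Context {d : Order.disp_t} {T : tbPreorderType d} {R : realType}.
Implicit Types (F Fl Fu pi : T -> R) (P : set T -> R).

Definition is_cdf F : Prop :=
  [/\ forall x, 0 <= F x <= 1,
      forall x y : T, (x <= y)%O -> F x <= F y
    & F \top%O = 1].

Definition is_pbox Fl Fu : Prop :=
  [/\ is_cdf Fl, is_cdf Fu & forall x, Fl x <= Fu x].

Definition extend_cdf F (z : option T) : R := if z is Some x then F x else 0.

(* F(x-); since 0- lies below every [x], the supremum is over a nonempty set. *)
Definition left_limit F (x : T) : R :=
  sup [set extend_cdf F z | z in [set z | lt_star z (Some x)]].

Definition finitely_additive_probability P : Prop :=
  [/\ forall A, 0 <= P A,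
      P [set: T] = 1
    & forall A B, A `&` B = set0 -> P (A `|` B) = P A + P B].

Definition pbox_credal_set Fl Fu : set (set T -> R) :=
  [set P | finitely_additive_probability P /\
           forall x, Fl x <= P (initial_segment x) <= Fu x].

Definition natural_extension Fl Fu (A : set T) : R :=
  sup [set P A | P in pbox_credal_set Fl Fu].

(* The library's [sup set0 = 0] is the convention wanted here and in
   [possibility]. *)
Definition is_possibility_measure Fl Fu : Prop :=
  forall A : set T,
    natural_extension Fl Fu A =
    sup [set natural_extension Fl Fu [set x] | x in A].

Definition possibility_distribution pi : Prop :=
  (forall x, 0 <= pi x <= 1) /\ sup (range pi) = 1.

Definition possibility pi (A : set T) : R := sup [set pi x | x in A].

Definition possibility_credal_set pi : set (set T -> R) :=
  [set P | finitely_additive_probability P /\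
           forall A, P A <= possibility pi A].

End PBox.

(* Main.v *)
(* The natural extension dominates every member of the credal set, so a p-box
   that is a possibility measure has its credal set inside that of any
   distribution bounding its members on singletons; the bounds
   [P {x} <= 1 - F(z)] for z < x and [P {x} <= F(x)] give one inclusion.
   Conversely, testing [Pi_1] on the complement of [[0, x]] and [Pi_2] on
   [[0, x]] returns the two p-box inequalities. *)
Require Import Defs.
From mathcomp Require Import all_boot all_order all_algebra.
From mathcomp Require Import all_classical all_reals all_analysis.
From mathcomp Require Import lra.
Import Order.TTheory GRing.Theory Num.Theory.
Local Open Scope classical_set_scope.
Local Open Scope ring_scope.

Section FinitelyAdditiveProbability.
Set Implicit Arguments.
Unset Strict Implicit.
Context {d : Order.disp_t} {T : tbPreorderType d} {R : realType}.
Context {P : set T -> R} (faP : finitely_additive_probability P).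

Lemma fap_setC (A : set T) : P (~` A) = 1 - P A.
Proof. by case: faP => _ PT PD; rewrite -PT -(setUv A) PD ?setICr//; lra. Qed.

Lemma fap_set0 : P set0 = 0.
Proof. by case: faP => _ PT _; rewrite -setCT fap_setC PT subrr. Qed.

Lemma fap_le (A B : set T) : A `<=` B -> P A <= P B.
Proof.
case: faP => P0 _ PD AB.
by rewrite -(setDUK AB) PD ?setDIK// lerDl P0.
Qed.

Lemma fap_le1 (A : set T) : P A <= 1.
Proof. by case: faP => _ <- _; apply: fap_le. Qed.

End FinitelyAdditiveProbability.

Section PBoxPossibility.
Set Implicit Arguments.
Unset Strict Implicit.
Context {d : Order.disp_t} {T : tbPreorderType d} {R : realType}.
Implicit Types (F Fl Fu pi : T -> R) (P : set T -> R) (A : set T).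

Lemma possibility0 pi : possibility pi set0 = 0.
Proof. by rewrite /possibility image_set0 sup0. Qed.

(** The condition [0 <= c] covers the empty set, whose supremum is 0. *)
Lemma possibility_le pi A c :
  0 <= c -> (forall x, A x -> pi x <= c) -> possibility pi A <= c.
Proof.
move=> c0 piA; have [->|/set0P[x Ax]] := eqVneq A set0.
  by rewrite possibility0.
by apply: ge_sup => [|_ [y Ay <-]]; [exists (pi x), x|exact: piA].
Qed.

(** The uniform bound [c] makes the supremum genuine rather than a default value. *)
Lemma possibility_ge pi A x c :
  (forall y, pi y <= c) -> A x -> pi x <= possibility pi A.
Proof.
by move=> pic Ax; apply: ub_le_sup; [exists c => _ [y _ <-]|exists x].
Qed.

Lemma natural_extension_ge Fl Fu P A :
  pbox_credal_set Fl Fu P -> P A <= natural_extension Fl Fu A.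
Proof.
move=> PM; apply: ub_le_sup; last by exists P.
by exists 1 => _ [Q [faQ _] <-]; exact: fap_le1.
Qed.

Lemma possibility_measure_credal_subset Fl Fu pi c :
  is_possibility_measure Fl Fu ->
  (forall x, 0 <= pi x <= c) ->
  (forall P x, pbox_credal_set Fl Fu P -> P [set x] <= pi x) ->
  pbox_credal_set Fl Fu `<=` possibility_credal_set pi.
Proof.
move=> poss pi01 Ppi P PM; have [faP _] := PM; split=> // A.
apply: (le_trans (natural_extension_ge A PM)); rewrite poss.
have pic y : pi y <= c by case/andP: (pi01 y).
have pi0 y : 0 <= pi y by case/andP: (pi01 y).
(* The supremum on the left is itself a [possibility], that of the distribution sending [x] to the
   natural extension of its singleton. *)
apply: possibility_le => [|x Ax].
  have [->|/set0P[x Ax]] := eqVneq A set0; first by rewrite possibility0.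
  exact: le_trans (pi0 x) (possibility_ge pic Ax).
apply: le_trans (possibility_ge pic Ax).
(* The credal set is nonempty because [P] belongs to it. *)
by apply: ge_sup => [|_ [Q QM <-]]; [exists (P [set x]), P|exact: Ppi].
Qed.

Lemma left_limit_ge F (z : option T) x :
  is_cdf F -> lt_star z (Some x) -> extend_cdf F z <= left_limit F x.
Proof.
case=> F01 _ _ zx; apply: ub_le_sup; last by exists z.
by exists 1 => _ [[y|] _ <-] //=; case/andP: (F01 y).
Qed.

Lemma left_limit_le F x c :
  (forall z, lt_star z (Some x) -> extend_cdf F z <= c) -> left_limit F x <= c.
Proof.
move=> Fc; apply: ge_sup; first by exists 0, None.
by move=> _ [z zx <-]; exact: Fc.
Qed.

(** Only the formal element [None] lies strictly below the bottom. This is where [pi1] attains the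
    value 1. *)
Lemma left_limit_bot F : is_cdf F -> left_limit F \bot%O = 0.
Proof.
move=> cF; apply/eqP; rewrite eq_le (left_limit_ge (z := None))// andbT.
by apply: left_limit_le => -[z|]//=; rewrite lt_leAnge le0x andbF.
Qed.

Lemma left_limit_itv F x : is_cdf F -> 0 <= left_limit F x <= 1.
Proof.
move=> cF; rewrite (left_limit_ge (z := None))//=.
apply: left_limit_le => -[z|]//= _.
by case: cF => F01 _ _; case/andP: (F01 z).
Qed.

Lemma possibility_distribution_max pi x :
  (forall y, 0 <= pi y <= 1) -> pi x = 1 -> possibility_distribution pi.
Proof.
move=> pi01 pix; split=> //; apply/eqP; rewrite eq_le; apply/andP; split.
  by apply: possibility_le => // y _; case/andP: (pi01 y).
rewrite -[leLHS]pix; apply: (possibility_ge (c := 1)) => // y.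
by case/andP: (pi01 y).
Qed.

End PBoxPossibility.

Theorem proposition21 (R : realType) (d : Order.disp_t) (T : tbPreorderType d)
  (le_total : forall x y : T, ((x <= y) || (y <= x))%O)
  (Fl Fu : T -> R) (pbox : is_pbox Fl Fu)
  (poss1 : is_possibility_measure Fl (\1_[set: T] : T -> R))
  (poss2 : is_possibility_measure (\1_(simeq_class (\top%O : T)) : T -> R) Fu) :
  let pi1 : T -> R := fun x => 1 - left_limit Fl x in
  let pi2 : T -> R := fun x => Fu x in
  [/\ possibility_distribution pi1, possibility_distribution pi2
    & pbox_credal_set Fl Fu =
      possibility_credal_set pi1 `&` possibility_credal_set pi2].
Proof.
move=> pi1 pi2; have [cFl [Fu01 Fu_homo Fu1] _] := pbox.
have pi101 x : 0 <= pi1 x <= 1.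
  by have /andP[l0 l1] := left_limit_itv x cFl; rewrite /pi1; lra.
split.
- by apply: (possibility_distribution_max (x := \bot%O)) => //;
    rewrite /pi1 left_limit_bot// subr0.
- exact: (possibility_distribution_max (x := \top%O)).
apply/seteqP; split=> P.
  move=> [faP Pbox]; split.
    apply: (possibility_measure_credal_subset poss1 pi101) => [Q x [faQ Qbox]|].
      suff : left_limit Fl x <= 1 - Q [set x] by rewrite /pi1; lra.
      (* For [None] the bound is nonnegativity of [Q]; for [z < x] the segment up to [z] misses [x],
         hence lies in the complement of the singleton. *)
      rewrite -fap_setC//; apply: left_limit_le => -[z|]/= zx; last first.
        by case: faQ.
      case/andP: (Qbox z) => + _ => /le_trans; apply; apply: fap_le => // y.
      rewrite /initial_segment/= => yz yx; move: zx.
      by rewrite lt_leAnge -yx yz andbF.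
    split=> // x; rewrite indicT fap_le1// andbT.
    by case/andP: (Pbox x).
  apply: (possibility_measure_credal_subset poss2 Fu01) => [Q x [faQ Qbox]|].
    case/andP: (Qbox x) => _; apply: le_trans; apply: fap_le => // y ->.
    exact: lexx.
  split=> // x; have /andP[_ ->] := Pbox x; rewrite andbT indicE.
  (* If [x] is equivalent to the top, its initial segment is the whole space and has mass 1;
     otherwise the lower bound is 0. *)
  case: (boolP (x \in _)) => [/set_mem/andP[_ topx]|_]; last by case: faP.
  have [_ <- _] := faP; apply: fap_le => // y _.
  exact: le_trans (lex1 y) topx.
move=> [[faP PPi1] [_ PPi2]]; split=> // x; apply/andP; split; last first.
  apply: (le_trans (PPi2 _)); apply: possibility_le => [|y].
    by case/andP: (Fu01 x).
  exact: Fu_homo.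
suff : P (~` initial_segment x) <= 1 - Fl x by rewrite fap_setC//; lra.
apply: (le_trans (PPi1 _)); apply: possibility_le => [|y /negP yx].
  by case: cFl => /(_ x)/andP[]; lra.
(* By totality, a point [y] outside the segment up to [x] satisfies [x < y], so [Fl x] is among the
   values whose supremum is the left limit at [y]. *)
rewrite lerD2l lerN2; apply: (left_limit_ge (z := Some x)) => //=.
by rewrite lt_leAnge yx andbT; have := le_total x y; rewrite (negbTE yx) orbF.
Qed.
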